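(* Let $\mathbf{w}(f,g)[m]=\exp(2\pi i(fm+g))$ be a rational wave sequence with $f=p/q\in\mathbb{Q}/\mathbb{Z}$ in lowest terms, and let $\Delta\mathbf{x}[m]=\mathbf{w}(f,g)[m]$ represent the instantaneous velocity / spatial displacement increment per time step. Over any full cycle period of $q$ temporal steps, the statistical properties of the discrete trajectory satisfy: (1) (Macroscopic spatial flatness: zero net drift) $$\langle\Delta\mathbf{x}\rangle_q=\frac1q\sum_{m=0}^{q-1}\Delta\mathbf{x}[m]=\frac{e^{2\pi ig}}{q}\sum_{m=0}^{q-1}e^{2\pi i\frac pq m}=0.$$ The center of mass of the background spacetime remains strictly stationary; on macroscopic observation scales $T\gg q\,\Delta t$, no directional drift or net spatial translation occurs. (2) (Non-vanishing zero-point kinetic energy: vacuum jitter) $$\sigma^2_{\mathrm{vac}}=\frac1q\sum_{m=0}^{q-1}\bigl\|\Delta\mathbf{x}[m]-\langle\Delta\mathbf{x}\rangle_q\bigr\|^2=\frac1q\sum_{m=0}^{q-1}|\mathbf{w}(f,g)[m]|^2=\frac1q\sum_{m=0}^{q-1}1=1>0.$$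
   Context: Here $m\in\mathbb{Z}$ is interpreted as a discrete time index with time step $\Delta t$ (time $t_m=m\,\Delta t$), $g\in\mathbb{Q}$ is a constant phase, $\|\cdot\|$ is the modulus on $\mathbb{C}$, and $\Delta\mathbf{x}$ is interpreted as the sequence of displacement increments of a discrete trajectory in $\mathbb{C}$. $\langle\cdot\rangle_q$ denotes the average over $q$ consecutive steps.
   Formalization: The condition q > 1 (f nonzero in Q/Z) is added: for q = 1 the increments are the constant e^{2πig}, so the mean is nonzero and the variance is 0, and both claims fail. *)

(* Defs.v *)
From mathcomp Require Import all_boot all_order all_algebra.
From mathcomp Require Import complex.
From mathcomp Require Import reals sequences exp trigo.

Set Implicit Arguments.
Unset Strict Implicit.
Unset Printing Implicit Defensive.

Import Order.TTheory GRing.Theory Num.Theory.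

Local Open Scope ring_scope.
Local Open Scope complex_scope.
Local Open Scope quotient_scope.

(* The predicate underlying the qualifier [Num.int] on [rat]. *)
Definition rat_int : zmodClosed rat :=
  GRing.ZmodClosed.clone rat (@Num.int_num_subdef rat) _.

Notation QmodZ := (Quotient.quot rat_int).
Notation normc := ComplexField.Normc.normc.

Definition expc (R : realType) (z : R[i]) : R[i] :=
  (expR (complex.Re z) * cos (complex.Im z))
    +i* (expR (complex.Re z) * sin (complex.Im z)).

Definition e2pi (R : realType) (x : rat) : R[i] :=
  expc (2 * pi%:C * 'i * ratr x).

(* A class modulo Z enters through its chosen representative; by [wave_pi] any
   other representative gives the same value. *)
Definition wave (R : realType) (f : QmodZ) (g : rat) (m : int) : R[i] :=
  e2pi R (repr f * m%:~R + g).

Lemma e2piE (R : realType) (x : rat) :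
  e2pi R x = cos (pi *+ 2 * ratr x) +i* sin (pi *+ 2 * ratr x).
Proof.
rewrite /e2pi.
have -> : 2 * pi%:C * 'i * ratr x = 0 +i* (pi *+ 2 * ratr x) :> R[i].
  rewrite -(fmorph_rat (real_complex R)) -(rmorph_nat (real_complex R)).
  rewrite -[pi *+ 2]mulr_natl.
  apply/eqP; rewrite eq_complex /= !(mulr0, mul0r, mulr1, addr0, add0r, subr0).
  by rewrite oppr0 mul0r !eqxx.
by rewrite /expc /= expR0 !mul1r.
Qed.

Lemma e2piDz (R : realType) (x : rat) (n : int) :
  e2pi R (x + n%:~R) = e2pi R x.
Proof.
have nat_case (y : rat) (k : nat) : e2pi R (y + k%:R) = e2pi R y.
  rewrite !e2piE rmorphD rmorph_nat mulrDr mulr_natr.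
  by rewrite (periodicn (@cosD2pi R)) (periodicn (@sinD2pi R)).
case: n => k; first exact: nat_case.
by rewrite NegzE mulrNz -[in RHS](subrK k.+1%:R x) nat_case.
Qed.

Lemma wave_pi (R : realType) (x g : rat) (m : int) :
  wave R (\pi_QmodZ x) g m = e2pi R (x * m%:~R + g).
Proof.
have /intrP[n repr_x] : repr (\pi_QmodZ x) - x \in rat_int.
  by rewrite Quotient.idealrBE; apply/eqP; rewrite reprK.
rewrite /wave -(subrK x (repr _)) repr_x.
rewrite -[RHS](e2piDz R _ (n * m)) intrM; congr (e2pi R _).
by rewrite mulrDl -addrA addrC.
Qed.

Definition window_mean (F : fieldType) (q : nat) (k : int) (u : int -> F) : F :=
  q%:R^-1 * \sum_(j < q) u (k + j%:Z).

Definition window_variance (R : realType) (q : nat) (k : int)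
    (u : int -> R[i]) : R :=
  window_mean q k (fun m => normc (u m - window_mean q k u) ^+ 2).

Definition is_trajectory (R : realType) (x dx : int -> R[i]) : Prop :=
  forall m : int, x (m + 1) - x m = dx m.

(* Main.v *)
Require Import Defs.
From mathcomp Require Import all_boot all_order all_algebra.
From mathcomp Require Import complex.
From mathcomp Require Import reals sequences exp trigo.

Import Order.TTheory GRing.Theory Num.Theory.
Local Open Scope ring_scope.
Local Open Scope complex_scope.
Local Open Scope quotient_scope.

(** The increments over a full cycle are a fixed unit complex number times
    [z ^+ 0, ..., z ^+ q.-1], where [z] stands for [e2pi R (p / q)].  Since
    [p] is prime to [q > 1], the fraction [p / q] is not an integer, so
    [z != 1] ([e2pi_eq1], which rests on the positivity of the sine on the
    open interval from 0 to [pi]), while [z ^+ q = 1]; the geometric sum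
    therefore vanishes ([sum_expr_root1]).  This is the absence of drift, and
    it makes the variance the mean of the squared moduli of the increments,
    each of which is 1 ([normc_e2pi]).

    A trajectory is a discrete primitive of its increments, so vanishing
    increment sums over the windows of length [q] say exactly that it is
    [q]-periodic, and the mean of a [q]-periodic sequence over [q] consecutive
    times does not depend on the first of them.  Being [q]-periodic with
    increments of modulus 1, it never moves by more than [q] from a starting
    point ([trajectory_bounded]), whatever the elapsed time; this bound is
    negligible against a time [N * dt] much larger than [q * dt]. *)

Lemma e2piD (R : realType) (x y : rat) :
  e2pi R (x + y) = e2pi R x * e2pi R y.
Proof.
rewrite !e2piE rmorphD mulrDr cosD sinD.
by apply/eqP; rewrite eq_complex /= eqxx addrC eqxx.
Qed.

Lemma e2pi0 (R : realType) : e2pi R 0 = 1.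
Proof. by rewrite e2piE rmorph0 mulr0 cos0 sin0. Qed.

Lemma e2piX (R : realType) (x : rat) (n : nat) :
  e2pi R (x * n%:R) = e2pi R x ^+ n.
Proof.
elim: n => [|n IHn]; first by rewrite mulr0 e2pi0.
by rewrite -natr1 mulrDr mulr1 e2piD IHn exprSr.
Qed.

Lemma normc_e2pi (R : realType) (x : rat) : normc (e2pi R x) = 1.
Proof. by rewrite e2piE /= cos2Dsin2 sqrtr1. Qed.

(** Reducing [x] modulo 1 leaves a fractional part [t] in [0, 1); by the
    duplication formula [cos (2 * pi * t) = 1] forces [sin (pi * t) = 0], which
    excludes [0 < t < 1]. *)
Lemma e2pi_eq1 (R : realType) (x : rat) :
  (e2pi R x == 1) = (x \is a Num.int).
Proof.
apply/eqP/idP => [e1|/intrP[n ->]]; last by rewrite -[_%:~R]add0r e2piDz e2pi0.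
set n := Num.floor x; pose t := x - n%:~R.
have xE : x = t + n%:~R by rewrite /t subrK.
have /andP[t_ge0 t_lt1] : 0 <= t < 1.
  have := floor_itv x; rewrite -/n intrD => /andP[nx xn].
  by rewrite /t subr_ge0 nx ltrBlDl.
have [t0|t_neq0] := eqVneq t 0; first by rewrite xE t0 add0r intr_int.
have t_gt0 : 0 < t by rewrite lt_def t_neq0.
have sin_gt0 : 0 < sin (pi * ratr t : R).
  apply: sin_gt0_pi; rewrite mulr_gt0 ?pi_gt0 ?ltr0q //=.
  by rewrite -[ltRHS]mulr1 ltr_pM2l ?pi_gt0 // -(rmorph1 (@ratr R)) ltr_rat.
move: e1; rewrite xE e2piDz e2piE => -[+ _].
rewrite mulrnAl cos_mulr2n cos2sin2 => /eqP; rewrite subr_eq -mulr2n.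
rewrite eqrMn2r /= -[eqbRHS]subr0 => /eqP/addrI/oppr_inj/eqP.
by rewrite sqrf_eq0 gt_eqF.
Qed.

Lemma coprime_frac_notin_int (p : int) (q : nat) :
  (1 < q)%N -> coprimez p q%:Z -> p%:~R / q%:R \isn't a @Num.int rat.
Proof.
move=> q_gt1 cpq; apply/negP => /intrP[n pq].
have q_neq0 : q%:R != 0 :> rat by rewrite pnatr_eq0 -lt0n ltnW.
have pE : p = n * q%:Z.
  by apply: (@intr_inj rat); rewrite intrM -pq divfK.
move: cpq; rewrite coprimezE pE abszM coprimeMl /= => /andP[_].
by rewrite /coprime gcdnn => /eqP q1; rewrite q1 in q_gt1.
Qed.

Lemma sum_expr_root1 (F : idomainType) (z : F) (q : nat) :
  z ^+ q = 1 -> z != 1 -> \sum_(j < q) z ^+ j = 0.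
Proof.
move=> zq z_neq1; have := subrX1 z q; rewrite zq subrr => /esym/eqP.
by rewrite mulf_eq0 subr_eq0 (negbTE z_neq1) => /eqP.
Qed.

Lemma int_step_const (T : Type) (u : int -> T) :
  (forall m, u (m + 1) = u m) -> forall m, u m = u 0.
Proof.
move=> step; elim/int_ind => [//|n IHn|n IHn].
- by rewrite -addn1 PoszD step.
- by rewrite -IHn -step -addn1 PoszD opprD subrK.
Qed.

Lemma trajectory_sum (R : realType) (x dx : int -> R[i]) (k : int) (n : nat) :
  is_trajectory x dx -> x (k + n%:Z) - x k = \sum_(j < n) dx (k + j%:Z).
Proof.
move=> tr; elim: n => [|n IHn]; first by rewrite big_ord0 addr0 subrr.
by rewrite big_ord_recr /= -IHn -tr -addn1 PoszD addrA [RHS]addrC addrA subrK.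
Qed.

(** Moving the window by one time step trades [x k] for [x (k + q)], which a
    [q]-periodic sequence does not notice. *)
Lemma window_mean_periodic (F : fieldType) (q : nat) (x : int -> F) :
  (forall k, x (k + q%:Z) = x k) ->
  forall k l, window_mean q k x = window_mean q l x.
Proof.
move=> per; suff step k : window_mean q (k + 1) x = window_mean q k x.
  move=> k l.
  by rewrite (int_step_const _ (window_mean q ^~ x) step k)
             (int_step_const _ (window_mean q ^~ x) step l).
rewrite /window_mean; congr (_ * _); apply: (@addrI _ (x k)).
transitivity (\sum_(j < q.+1) x (k + j%:Z)).
  rewrite big_ord_recl /= addr0; congr (_ + _); apply: eq_bigr => j _.
  by rewrite -addrA.
by rewrite big_ord_recr /= per addrC.
Qed.

Lemma normc_sum_le (R : realType) (n : nat) (u : 'I_n -> R[i]) :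
  (forall j, normc (u j) <= 1) -> normc (\sum_j u j) <= n%:R.
Proof.
elim: n u => [|n IHn] u u1; first by rewrite big_ord0 ComplexField.Normc.normc0.
rewrite big_ord_recr /= -natr1; apply: le_trans (le_normcD _ _) _.
by apply: lerD => //; apply: IHn.
Qed.

(** Whole periods do not count: only the [N %% q] remaining steps do. *)
Lemma trajectory_bounded (R : realType) (x dx : int -> R[i]) (q : nat) :
  (0 < q)%N -> is_trajectory x dx -> (forall m, normc (dx m) <= 1) ->
  (forall k n : int, x (k + n * q%:Z) = x k) ->
  forall (k : int) (N : nat), normc (x (k + N%:Z) - x k) <= q%:R.
Proof.
move=> q_gt0 tr dx1 per k N.
have -> : x (k + N%:Z) = x (k + (N %% q)%N%:Z).
  by rewrite {1}(divn_eq N q) PoszD PoszM addrCA addrC per.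
rewrite (trajectory_sum _ _ _ _ _ tr).
apply: le_trans (normc_sum_le _ _ _ _) _ => [j|]; first exact: dx1.
by rewrite ler_nat ltnW // ltn_mod.
Qed.

Theorem theorem13p5 (R : realType) (f : QmodZ) (g : rat) (p : int) (q : nat)
    (q_gt1 : (1 < q)%N) (pq_coprime : coprimez p q%:Z)
    (f_eq : f = \pi_QmodZ (p%:~R / q%:R)) :
  let dx : int -> R[i] := wave R f g in
  (* (1) zero mean increment over every full cycle *)
  (forall k : int,
    [/\ window_mean q k dx = q%:R^-1 * \sum_(j < q) dx (k + j%:Z),
        window_mean q k dx =
          e2pi R g / q%:R *
          \sum_(j < q) e2pi R (p%:~R / q%:R * (k + j%:Z)%:~R) &
        window_mean q k dx = 0])
  (* (1) every trajectory with these increments: no net translation over full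
     cycles, a stationary center of mass, and a mean drift velocity that
     vanishes at time scales T = N dt much larger than q dt *)
  /\ (forall x : int -> R[i], is_trajectory x dx ->
      [/\ forall k n : int, x (k + n * q%:Z) = x k,
          forall k l : int, window_mean q k x = window_mean q l x &
          forall dt eps : R, 0 < dt -> 0 < eps ->
            exists K : R, forall (k : int) (N : nat),
              K * (q%:R * dt) <= N%:R * dt ->
              normc (x (k + N%:Z) - x k) <= eps * (N%:R * dt)])
  (* (2) unit variance over every full cycle *)
  /\ (forall k : int,
      [/\ window_variance q k dx =
            q%:R^-1 * \sum_(j < q)
              normc (dx (k + j%:Z) - window_mean q k dx) ^+ 2,
          window_variance q k dx =
            q%:R^-1 * \sum_(j < q) normc (dx (k + j%:Z)) ^+ 2,
          window_variance q k dx = q%:R^-1 * \sum_(j < q) 1,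
          window_variance q k dx = 1 &
          0 < window_variance q k dx]).
Proof.
move=> dx; have q_gt0 : (0 < q)%N by exact: ltnW.
have qR_neq0 : q%:R != 0 :> R by rewrite pnatr_eq0 -lt0n.
have qQ_neq0 : q%:R != 0 :> rat by rewrite pnatr_eq0 -lt0n.
set r : rat := p%:~R / q%:R in f_eq *.
have dxE m : dx m = e2pi R (r * m%:~R + g) by rewrite /dx f_eq wave_pi.
have dx1 m : normc (dx m) = 1 by rewrite dxE normc_e2pi.
have sum0 k : \sum_(j < q) dx (k + j%:Z) = 0.
  under eq_bigr => j _.
    rewrite dxE intrD mulrDr addrAC e2piD [(j%:Z)%:~R]/(j%:R) e2piX; over.
  rewrite -mulr_sumr sum_expr_root1 ?mulr0 //.
    by rewrite -e2piX divfK //; apply/eqP; rewrite e2pi_eq1 intr_int.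
  by rewrite e2pi_eq1 coprime_frac_notin_int.
have mean0 k : window_mean q k dx = 0 by rewrite /window_mean sum0 mulr0.
split=> [k|].
  split=> //; rewrite /window_mean [e2pi R g / _]mulrC -mulrA; congr (_ * _).
  by rewrite mulr_sumr; apply: eq_bigr => j _; rewrite dxE e2piD mulrC.
split=> [x tr|k].
  have per k : x (k + q%:Z) = x k.
    by apply/eqP; rewrite -subr_eq0 (trajectory_sum _ _ _ _ _ tr) sum0.
  have perz k n : x (k + n * q%:Z) = x k.
    rewrite (int_step_const _ (fun n => x (k + n * q%:Z))) ?mul0r ?addr0 // => m.
    by rewrite mulrDl mul1r addrA per.
  split=> // [|dt eps dt_gt0 eps_gt0]; first exact: window_mean_periodic.
  (* The displacement is at most [q]; this [K] turns the assumption on the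
     elapsed time into [q <= eps * (N * dt)]. *)
  exists (eps * dt)^-1 => k N.
  rewrite invfM -mulrA [dt^-1 * _]mulrC mulfK ?gt_eqF //.
  rewrite ler_pdivrMl // => le_qN; apply: le_trans le_qN.
  by apply: trajectory_bounded => // m; rewrite dx1.
have varE : window_variance q k dx = q%:R^-1 * \sum_(j < q) 1.
  rewrite /window_variance mean0 /window_mean; congr (_ * _).
  by apply: eq_bigr => j _; rewrite subr0 dx1 expr1n.
have var1 : window_variance q k dx = 1.
  by rewrite varE sumr_const card_ord mulVf.
split=> //; last by rewrite var1.
by rewrite varE; congr (_ * _); apply: eq_bigr => j _; rewrite dx1 expr1n.
Qed.
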